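(* Let $\Phi$ be any set of modal formulas each of the form $\Diamond^m p\to\Diamond^n p$ with $n>m>1$ (equivalently, modulo $\mathbf{K}$, $\Box^n p\to\Box^m p$ with $n>m>1$). Then the normal modal logic $\mathbf{K}\oplus\Phi$ has the finite model property.
   Context: $\mathbf{K}$ is the least normal modal logic in the basic modal language (with $\bot$, propositional variables, $\neg$, $\lor$, $\Diamond$; $\Box=\neg\Diamond\neg$), and $\mathbf{K}\oplus\Phi$ is the least normal modal logic containing $\Phi$. $\Diamond^k$ denotes $k$ nested diamonds. A logic has the finite model property if every formula not in the logic is refuted in some finite model (Kripke frame with valuation) validating the logic. *)

(* Defs.v *)
From Stdlib Require Import FinFun.

Inductive formula : Type :=
| Bot : formula
| Var : nat -> formula
| Neg : formula -> formula
| Or  : formula -> formula -> formula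
| Dia : formula -> formula.

Definition Imp (a b : formula) : formula := Or (Neg a) b.
Definition And (a b : formula) : formula := Neg (Or (Neg a) (Neg b)).
Definition Iff (a b : formula) : formula := And (Imp a b) (Imp b a).
Definition Box (a : formula) : formula := Neg (Dia (Neg a)).

Definition DiaN (k : nat) (a : formula) : formula := Nat.iter k Dia a.

Fixpoint subst (s : nat -> formula) (a : formula) : formula :=
  match a with
  | Bot => Bot
  | Var i => s i
  | Neg b => Neg (subst s b)
  | Or b c => Or (subst s b) (subst s c)
  | Dia b => Dia (subst s b)
  end.

(* Variables and diamond formulas alike are treated as propositional atoms, so
   [tautology] also covers the modal substitution instances of tautologies. *)
Fixpoint prop_eval (v : formula -> bool) (a : formula) : bool :=
  match a with
  | Bot => false
  | Var _ | Dia _ => v a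
  | Neg b => negb (prop_eval v b)
  | Or b c => orb (prop_eval v b) (prop_eval v c)
  end.

Definition tautology (a : formula) : Prop :=
  forall v : formula -> bool, prop_eval v a = true.

(* Since diamond is primitive and [Box] an abbreviation, the duality axiom
   [nl_dual] does not follow from [nl_K] and necessitation. *)
Record normal_logic (L : formula -> Prop) : Prop := {
  nl_taut  : forall a, tautology a -> L a;
  nl_K     : L (Imp (Box (Imp (Var 0) (Var 1)))
                    (Imp (Box (Var 0)) (Box (Var 1))));
  nl_dual  : L (Iff (Dia (Var 0)) (Neg (Box (Neg (Var 0)))));
  nl_mp    : forall a b, L (Imp a b) -> L a -> L b;
  nl_subst : forall s a, L a -> L (subst s a);
  nl_nec   : forall a, L a -> L (Box a)
}.

Definition K_plus (Phi : formula -> Prop) (a : formula) : Prop :=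
  forall L : formula -> Prop,
    normal_logic L -> (forall b, Phi b -> L b) -> L a.

Record model : Type := {
  world : Type;
  acc   : world -> world -> Prop;
  val   : nat -> world -> Prop
}.

Fixpoint sat (M : model) (w : world M) (a : formula) : Prop :=
  match a with
  | Bot => False
  | Var i => val M i w
  | Neg b => ~ sat M w b
  | Or b c => sat M w b \/ sat M w c
  | Dia b => exists u : world M, acc M w u /\ sat M u b
  end.

Definition validates (M : model) (L : formula -> Prop) : Prop :=
  forall a, L a -> forall w : world M, sat M w a.

Definition refutes (M : model) (a : formula) : Prop :=
  exists w : world M, ~ sat M w a.

Definition finite_model_property (L : formula -> Prop) : Prop :=
  forall a, ~ L a ->
    exists M : model, Finite (world M) /\ validates M L /\ refutes M a.

(* Main.v *)
From Stdlib Require Import Arith Lia List FinFun Cantor Classical ClassicalEpsilon.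
Require Import Defs.
Import ListNotations.

(** Let [M] be the canonical model of the logic and let the refuted formula have
    modal depth [d].  The worlds of the finite model are pairs [(k, x)] with
    [k <= d] and [x] a world of [M] taken up to equivalence for formulas of depth
    at most [k]; there is an edge from [(k, x)] to [(l, y)] when [k <= l + 1] and
    either [k = 0] or [x] sees a world that agrees with [y] up to depth [k - 1].
    Formulas of depth at most [k] keep their truth value at [(k, x)].

    A path of length [m <= k] from [(k, x)] to [(l, y)] shows that [x] satisfies
    [DiaN m c], where [c] describes [y] up to depth [k - m].  The axiom turns this
    into [DiaN n c], and following its witnesses down one level at a time gives a
    path of length [n]: either it can end in [(l, y)] because [n > m], or it reaches
    level [0] before its last step, and from level [0] every world is accessible. *)

(** * Derivability and the canonical model *)

Definition Top : formula := Neg Bot.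

Lemma normal_logic_K_plus (Phi : formula -> Prop) : normal_logic (K_plus Phi).
Proof.
  split.
  - intros a Ha L HL _. now apply (nl_taut L HL).
  - intros L HL _. apply (nl_K L HL).
  - intros L HL _. apply (nl_dual L HL).
  - intros a b Hab Ha L HL HPhi. apply (nl_mp L HL a); [now apply Hab | now apply Ha].
  - intros s a Ha L HL HPhi. apply (nl_subst L HL). now apply Ha.
  - intros a Ha L HL HPhi. apply (nl_nec L HL). now apply Ha.
Qed.

Lemma K_plus_axiom (Phi : formula -> Prop) (a : formula) : Phi a -> K_plus Phi a.
Proof. intros Ha L _ HL. auto. Qed.

(** An injective numbering, so that the Lindenbaum construction can treat formulas one at a time. *)
Fixpoint code (a : formula) : nat :=
  match a with
  | Bot => to_nat (0, 0)
  | Var i => to_nat (1, i)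
  | Neg b => to_nat (2, code b)
  | Or b c => to_nat (3, to_nat (code b, code c))
  | Dia b => to_nat (4, code b)
  end.

Lemma code_inj (a b : formula) : code a = code b -> a = b.
Proof.
  revert b; induction a as [|i|a IH|a IHa b IHb|a IH]; intros a'; destruct a';
    cbn [code]; intros H; apply to_nat_inj in H; pose proof (f_equal fst H) as Htag;
    try discriminate; clear Htag; apply (f_equal snd) in H; cbn [snd] in H.
  - reflexivity.
  - now f_equal.
  - f_equal; auto.
  - apply to_nat_inj in H. f_equal.
    + exact (IHa _ (f_equal fst H)).
    + exact (IHb _ (f_equal snd H)).
  - f_equal; auto.
Qed.

Section Canonical.

Variable L : formula -> Prop.
Hypothesis HL : normal_logic L.

(** Modus ponens is the only rule applied to premises; necessitation and substitution stay inside
    [L]. This makes the deduction theorem [derives_imp] hold. *)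
Inductive derives (T : formula -> Prop) : formula -> Prop :=
| derives_ax a : T a -> derives T a
| derives_logic a : L a -> derives T a
| derives_mp a b : derives T (Imp a b) -> derives T a -> derives T b.

Definition add (T : formula -> Prop) (a b : formula) : Prop := T b \/ b = a.

Definition consistent (T : formula -> Prop) : Prop := ~ derives T Bot.

Ltac taut :=
  apply derives_logic; apply (nl_taut L HL); intros v; cbn;
  repeat match goal with |- context [prop_eval v ?a] => destruct (prop_eval v a) end;
  repeat match goal with |- context [v ?a] => destruct (v a) end;
  reflexivity.

Lemma derives_mono (T U : formula -> Prop) (a : formula) :
  (forall b, T b -> U b) -> derives T a -> derives U a.
Proof.
  intros TU; induction 1; eauto using derives_ax, derives_logic, derives_mp.
Qed.

Lemma derives_imp (T : formula -> Prop) (a b : formula) :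
  derives (add T a) b -> derives T (Imp a b).
Proof.
  induction 1 as [b [Hb | ->] | b Hb | b c _ IH1 _ IH2].
  - apply derives_mp with b; [taut | now apply derives_ax].
  - taut.
  - apply derives_mp with b; [taut | now apply derives_logic].
  - apply derives_mp with (Imp a b); auto.
    apply derives_mp with (Imp a (Imp b c)); auto. taut.
Qed.

Lemma derives_neg (T : formula -> Prop) (a : formula) :
  ~ consistent (add T a) -> derives T (Neg a).
Proof.
  intros H. apply NNPP, derives_imp in H.
  apply derives_mp with (Imp a Bot); auto. taut.
Qed.

Lemma derives_absurd (T : formula -> Prop) (a : formula) :
  derives T a -> derives T (Neg a) -> derives T Bot.
Proof.
  intros H1 H2. apply derives_mp with a; auto.
  apply derives_mp with (Neg a); auto. taut.
Qed.

Record maximal_consistent (T : formula -> Prop) : Prop := {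
  mcs_con : consistent T;
  mcs_max : forall a, consistent (add T a) -> T a
}.

Lemma mcs_derives (T : formula -> Prop) (a : formula) :
  maximal_consistent T -> derives T a -> T a.
Proof.
  intros [Hc Hm] Ha. apply Hm. intros H. apply derives_imp in H.
  apply Hc. now apply derives_mp with a.
Qed.

Lemma mcs_neg (T : formula -> Prop) (a : formula) :
  maximal_consistent T -> T (Neg a) <-> ~ T a.
Proof.
  intros HT; split.
  - intros H1 H2. apply (mcs_con T HT).
    apply derives_absurd with a; now apply derives_ax.
  - intros H. apply mcs_derives; auto. apply derives_neg.
    intros Hc. apply H. now apply (mcs_max T HT).
Qed.

Lemma mcs_or (T : formula -> Prop) (a b : formula) :
  maximal_consistent T -> T (Or a b) <-> T a \/ T b.
Proof.
  intros HT; split.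
  - intros H. apply NNPP; intros Hn. apply not_or_and in Hn as [Ha Hb].
    apply mcs_neg in Ha, Hb; auto. apply (mcs_con T HT).
    apply derives_absurd with (Or a b); [now apply derives_ax|].
    apply derives_mp with (Neg b); [|now apply derives_ax].
    apply derives_mp with (Neg a); [|now apply derives_ax]. taut.
  - intros [H | H]; apply mcs_derives; auto;
      (eapply derives_mp; [|apply derives_ax, H]); taut.
Qed.

Lemma derives_subst (T : formula -> Prop) (s : nat -> formula) (a : formula) :
  L a -> derives T (subst s a).
Proof. intros H. apply derives_logic. now apply (nl_subst L HL). Qed.

Lemma derives_K (T : formula -> Prop) (a b : formula) :
  derives T (Imp (Box (Imp a b)) (Imp (Box a) (Box b))).
Proof.
  exact (derives_subst T (fun i => match i with 0 => a | _ => b end) _ (nl_K L HL)).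
Qed.

Lemma derives_dual (T : formula -> Prop) (a : formula) :
  derives T (Iff (Dia a) (Neg (Box (Neg a)))).
Proof. exact (derives_subst T (fun _ => a) _ (nl_dual L HL)). Qed.

Lemma mcs_dual (T : formula -> Prop) (a : formula) :
  maximal_consistent T -> T (Dia a) <-> ~ T (Box (Neg a)).
Proof.
  intros HT. rewrite <- mcs_neg by assumption.
  split; intros H; apply mcs_derives; auto;
    (eapply derives_mp; [|apply derives_ax, H]);
    (eapply derives_mp; [|apply (derives_dual T a)]);
    unfold Iff, And; taut.
Qed.

(** Members of [L] are boxed by necessitation, and axiom K carries the box through modus ponens. *)
Lemma derives_box (T : formula -> Prop) (a : formula) :
  derives (fun b => T (Box b)) a -> derives T (Box a).
Proof.
  induction 1 as [a Ha | a Ha | a b _ IH1 _ IH2].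
  - now apply derives_ax.
  - apply derives_logic. now apply (nl_nec L HL).
  - apply derives_mp with (Box a); auto.
    apply derives_mp with (Box (Imp a b)); auto. apply derives_K.
Qed.

(** * Lindenbaum's lemma *)

Fixpoint stage (T : formula -> Prop) (n : nat) : formula -> Prop :=
  match n with
  | 0 => T
  | S n => fun a => stage T n a \/ (code a = n /\ consistent (add (stage T n) a))
  end.

Lemma stage_mono (T : formula -> Prop) (m n : nat) (a : formula) :
  m <= n -> stage T m a -> stage T n a.
Proof. induction 1; cbn; auto. Qed.

(** Since [code] is injective, each stage adds at most one formula, and only one consistent with the
    stage before. *)
Lemma stage_consistent (T : formula -> Prop) (n : nat) :
  consistent T -> consistent (stage T n).
Proof.
  intros HT; induction n as [|n IH]; auto.
  destruct (classic (exists a, code a = n /\ consistent (add (stage T n) a)))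
    as [[a [Ha Hc]] | Hn]; intros H.
  - apply Hc. eapply derives_mono, H. intros b [Hb | [Hb _]]; [now left|].
    right. apply code_inj. congruence.
  - apply IH. eapply derives_mono, H. intros b [Hb | Hb]; auto. destruct Hn; eauto.
Qed.

Lemma derives_stage (T : formula -> Prop) (a : formula) :
  derives (fun b => exists n, stage T n b) a -> exists n, derives (stage T n) a.
Proof.
  induction 1 as [a [n Ha] | a Ha | a b _ [m IH1] _ [n IH2]].
  - exists n. now apply derives_ax.
  - exists 0. now apply derives_logic.
  - exists (max m n). apply derives_mp with a.
    + eapply derives_mono, IH1. intros c; apply stage_mono; lia.
    + eapply derives_mono, IH2. intros c; apply stage_mono; lia.
Qed.

Lemma lindenbaum (T : formula -> Prop) :
  consistent T -> exists U, maximal_consistent U /\ forall a, T a -> U a.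
Proof.
  intros HT. exists (fun a => exists n, stage T n a); split; [split|].
  - intros H. apply derives_stage in H as [n H]. now apply (stage_consistent T n) in H.
  (* [a] is considered at stage [S (code a)]; being consistent with the union, it is consistent with
     the smaller stage [code a]. *)
  - intros a Ha. exists (S (code a)). right; split; auto.
    intros H. apply Ha. eapply derives_mono, H.
    intros b [Hb | Hb]; [left; eauto | now right].
  - intros a Ha. now exists 0.
Qed.

(** * The canonical model and its truth lemma *)

Definition canonical_model : model := {|
  world := {T : formula -> Prop | maximal_consistent T};
  acc := fun x y => forall a, proj1_sig x (Box a) -> proj1_sig y a;
  val := fun i x => proj1_sig x (Var i)
|}.

Lemma canonical_mcs (x : world canonical_model) : maximal_consistent (proj1_sig x).
Proof. exact (proj2_sig x). Qed.

Lemma sat_canonical (a : formula) (x : world canonical_model) :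
  sat canonical_model x a <-> proj1_sig x a.
Proof.
  revert x; induction a as [|i|a IH|a IHa b IHb|a IH]; intros x;
    pose proof (canonical_mcs x) as Hx.
  - split; [intros []|]. intros H. apply (mcs_con _ Hx). now apply derives_ax.
  - reflexivity.
  - rewrite (mcs_neg _ _ Hx). cbn [sat]. now rewrite IH.
  - rewrite (mcs_or _ _ _ Hx). cbn [sat]. now rewrite IHa, IHb.
  - cbn [sat]. split.
    + intros [y [Hxy Hy]]. apply IH in Hy. apply mcs_dual; auto.
      intros H. apply Hxy in H. apply mcs_neg in H; auto using canonical_mcs.
    + intros H. apply mcs_dual in H; auto.
      (* The successor extends [a] together with all formulas boxed in [x]. Were these inconsistent,
         [derives_box] would put [Box (Neg a)] into [x]. *)
      destruct (lindenbaum (add (fun b => proj1_sig x (Box b)) a)) as [U [HU Hsub]].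
      { apply NNPP; intros Hc. apply derives_neg, derives_box in Hc.
        apply H. apply mcs_derives; auto. }
      exists (exist _ U HU). split.
      * intros b Hb. apply Hsub. now left.
      * apply IH, Hsub. now right.
Qed.

Lemma canonical_validates : validates canonical_model L.
Proof.
  intros a Ha x. apply sat_canonical. apply mcs_derives; [apply canonical_mcs|].
  now apply derives_logic.
Qed.

Lemma canonical_refutes (a : formula) : ~ L a -> refutes canonical_model a.
Proof.
  intros Ha. destruct (lindenbaum (add L (Neg a))) as [U [HU Hsub]].
  { intros H. apply Ha. apply derives_imp in H.
    (* With [L] itself as the premises, derivations do not leave [L], because it is closed under
       modus ponens. *)
    assert (Hd : forall b, derives L b -> L b).
    { induction 1; auto. eapply (nl_mp L HL); eauto. }
    apply Hd. apply derives_mp with (Imp (Neg a) Bot); auto. taut. }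
  exists (exist _ U HU). rewrite sat_canonical. cbn.
  apply mcs_neg; auto. apply Hsub. now right.
Qed.

End Canonical.

(** * Soundness *)

(** Truth at a world is itself a valuation of variables and diamond formulas, which gives soundness
    of tautologies. *)
Lemma prop_eval_sat (M : model) (w : world M) (a : formula) :
  prop_eval (fun b => if excluded_middle_informative (sat M w b) then true else false) a
    = true <-> sat M w a.
Proof.
  induction a as [|i|a IH|a IHa b IHb|a IH]; cbn [prop_eval].
  - split; [discriminate | intros []].
  - destruct excluded_middle_informative; intuition discriminate.
  - cbn [sat]. rewrite <- IH. destruct prop_eval; intuition discriminate.
  - cbn [sat]. rewrite <- IHa, <- IHb. apply Bool.orb_true_iff.
  - destruct excluded_middle_informative; intuition discriminate.
Qed.

Lemma sat_imp (M : model) (w : world M) (a b : formula) :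
  sat M w (Imp a b) <-> (sat M w a -> sat M w b).
Proof. cbn. destruct (classic (sat M w a)); tauto. Qed.

Lemma sat_and (M : model) (w : world M) (a b : formula) :
  sat M w (And a b) <-> sat M w a /\ sat M w b.
Proof. cbn. destruct (classic (sat M w a)), (classic (sat M w b)); tauto. Qed.

Lemma sat_box (M : model) (w : world M) (a : formula) :
  sat M w (Box a) <-> forall u, acc M w u -> sat M u a.
Proof.
  cbn. split.
  - intros H u Hu. apply NNPP. eauto.
  - intros H [u [Hu Hn]]. auto.
Qed.

(** Ranging over all valuations yields closure under substitution, which truth in one fixed model
    can lack. *)
Definition frame_valid (W : Type) (R : W -> W -> Prop) (a : formula) : Prop :=
  forall V w, sat {| world := W; acc := R; val := V |} w a.

Lemma sat_subst (W : Type) (R : W -> W -> Prop) (V : nat -> W -> Prop)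
    (s : nat -> formula) (a : formula) (w : W) :
  sat {| world := W; acc := R; val := V |} w (subst s a) <->
  sat {| world := W; acc := R;
         val := fun i u => sat {| world := W; acc := R; val := V |} u (s i) |} w a.
Proof.
  revert w; induction a as [|i|a IH|a IHa b IHb|a IH]; intros w; cbn.
  - tauto.
  - tauto.
  - now rewrite IH.
  - now rewrite IHa, IHb.
  - split; intros [u [Hu Hs]]; exists u; split; auto; now apply IH.
Qed.

Lemma normal_logic_frame_valid (W : Type) (R : W -> W -> Prop) :
  normal_logic (frame_valid W R).
Proof.
  split.
  - intros a Ha V w. apply prop_eval_sat, Ha.
  - intros V w. rewrite !sat_imp, !sat_box. intros H1 H2 u Hu.
    specialize (H1 u Hu). rewrite sat_imp in H1. auto.
  - intros V w. unfold Iff. rewrite sat_and, !sat_imp. split.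
    + intros [u [Hu Hs]]. intros H. rewrite sat_box in H. now apply (H u).
    + intros H. apply NNPP; intros Hn. apply H. apply sat_box.
      intros u Hu Hs. apply Hn. now exists u.
  - intros a b Hab Ha V w. specialize (Hab V w). rewrite sat_imp in Hab. apply Hab, Ha.
  - intros s a Ha V w. apply sat_subst, Ha.
  - intros a Ha V w. apply sat_box. intros u _. apply Ha.
Qed.

(** * Paths and iterated diamonds *)

Fixpoint path {W : Type} (R : W -> W -> Prop) (n : nat) (x y : W) : Prop :=
  match n with
  | 0 => x = y
  | S n => exists z, R x z /\ path R n z y
  end.

Lemma path_app {W : Type} (R : W -> W -> Prop) (m n : nat) (x y : W) :
  path R (m + n) x y <-> exists z, path R m x z /\ path R n z y.
Proof.
  revert x; induction m as [|m IH]; intros x; cbn.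
  - split; [eauto | intros [z [-> H]]; auto].
  - split.
    + intros [u [Hu H]]. apply IH in H as [z [H1 H2]]. eauto.
    + intros [z [[u [Hu H1]] H2]]. exists u; split; auto. apply IH. eauto.
Qed.

Lemma sat_DiaN (M : model) (n : nat) (a : formula) (x : world M) :
  sat M x (DiaN n a) <-> exists y, path (acc M) n x y /\ sat M y a.
Proof.
  revert x; induction n as [|n IH]; intros x.
  - cbn. split; [eauto | intros [y [-> H]]; auto].
  - change (DiaN (S n) a) with (Dia (DiaN n a)). cbn. split.
    + intros [z [Hz H]]. apply IH in H as [y [H1 H2]]. eauto.
    + intros [y [[z [Hz H1]] H2]]. exists z; split; auto. apply IH. eauto.
Qed.

Lemma frame_valid_DiaN (W : Type) (R : W -> W -> Prop) (p m n : nat) :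
  (forall x y, path R m x y -> path R n x y) ->
  frame_valid W R (Imp (DiaN m (Var p)) (DiaN n (Var p))).
Proof.
  intros H V w. rewrite sat_imp, !sat_DiaN. intros [y [Hy Hs]]. eauto.
Qed.

Lemma DiaN_succ_r (n : nat) (a : formula) : DiaN (S n) a = DiaN n (Dia a).
Proof. apply Nat.iter_succ_r. Qed.

Lemma subst_DiaN (s : nat -> formula) (n : nat) (a : formula) :
  subst s (DiaN n a) = DiaN n (subst s a).
Proof.
  induction n as [|n IH]; auto.
  change (Dia (subst s (DiaN n a)) = Dia (DiaN n (subst s a))). now rewrite IH.
Qed.

(** * Formulas of bounded depth *)

(** Bounding variables as well as depth leaves finitely many formulas up to equivalence. *)
Fixpoint bounded (N k : nat) (a : formula) : Prop :=
  match a with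
  | Bot => True
  | Var i => i < N
  | Neg b => bounded N k b
  | Or b c => bounded N k b /\ bounded N k c
  | Dia b => match k with 0 => False | S k => bounded N k b end
  end.

Lemma bounded_mono (N N' k k' : nat) (a : formula) :
  N <= N' -> k <= k' -> bounded N k a -> bounded N' k' a.
Proof.
  intros HN. revert k k'; induction a as [|i|a IH|a IHa b IHb|a IH];
    intros k k' Hk; cbn; try (intuition eauto; fail).
  - lia.
  - destruct k, k'; intuition (try lia). apply IH with k; auto; lia.
Qed.

Lemma bounded_exists (a : formula) : exists N k, bounded N k a.
Proof.
  induction a as [|i|a IH|a [N1 [k1 H1]] b [N2 [k2 H2]]|a [N [k H]]].
  - now exists 0, 0.
  - exists (S i), 0. cbn; lia.
  - exact IH.
  - exists (max N1 N2), (max k1 k2). cbn. split.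
    + apply (bounded_mono N1 _ k1); auto; lia.
    + apply (bounded_mono N2 _ k2); auto; lia.
  - now exists N, (S k).
Qed.

Lemma bounded_DiaN (N k n : nat) (a : formula) :
  bounded N k a -> bounded N (n + k) (DiaN n a).
Proof. intros H; induction n; auto. Qed.

Definition agree (M : model) (F : formula -> Prop) (x y : world M) : Prop :=
  forall a, F a -> (sat M x a <-> sat M y a).

(** State descriptions over [F]: one conjunction for each choice of signs. *)
Fixpoint descriptions (F : list formula) : list formula :=
  match F with
  | [] => [Top]
  | a :: F => map (And a) (descriptions F) ++ map (And (Neg a)) (descriptions F)
  end.

Lemma bounded_descriptions (N k : nat) (F : list formula) :
  (forall a, In a F -> bounded N k a) ->
  forall c, In c (descriptions F) -> bounded N k c.
Proof.
  induction F as [|a F IH]; intros HF c; cbn [descriptions].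
  - intros [<- | []]. exact I.
  - rewrite in_app_iff, !in_map_iff.
    assert (Ha : bounded N k a) by (apply HF; now left).
    intros [[b [<- Hb]] | [b [<- Hb]]]; apply IH in Hb; cbn; auto;
      intros; apply HF; now right.
Qed.

Lemma descriptions_spec (M : model) (F : list formula) (x : world M) :
  exists c, In c (descriptions F) /\
    forall y, sat M y c <-> agree M (fun a => In a F) x y.
Proof.
  induction F as [|a F [c [Hc HF]]].
  - exists Top. split; [now left|]. intros y. split; [intros _ b [] | cbn; tauto].
  - assert (Hsplit : forall y, agree M (fun b => In b (a :: F)) x y <->
              (sat M x a <-> sat M y a) /\ agree M (fun b => In b F) x y).
    { intros y. split.
      - intros H. split; [|intros b Hb]; apply H; [now left | now right].
      - intros [H1 H2] b [<- | Hb]; auto. }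
    destruct (classic (sat M x a)) as [Ha | Ha].
    + exists (And a c). split.
      { cbn. apply in_app_iff. left. now apply in_map. }
      intros y. rewrite sat_and, HF, Hsplit. tauto.
    + exists (And (Neg a) c). split.
      { cbn. apply in_app_iff. right. now apply in_map. }
      intros y. rewrite sat_and, HF, Hsplit. cbn [sat]. tauto.
Qed.

(** Whether a successor satisfies a formula of depth [k] depends only on its description over the
    basis for [k]. So the variables and the diamonds of these descriptions form a basis for
    [S k]. *)
Lemma finite_basis (M : model) (N k : nat) :
  exists F, (forall a, In a F -> bounded N k a) /\
    forall x y, agree M (fun a => In a F) x y -> agree M (bounded N k) x y.
Proof.
  induction k as [|k [F [HF HA]]].
  - exists (map Var (seq 0 N)). split.
    + intros a. rewrite in_map_iff. intros [i [<- Hi]]. apply in_seq in Hi. cbn; lia.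
    + intros x y H a; induction a as [|i|a IH|a IHa b IHb|a IH]; cbn [bounded]; intros Hb.
      * reflexivity.
      * apply H. apply in_map, in_seq. lia.
      * cbn [sat]. now rewrite IH.
      * cbn [sat]. now rewrite IHa, IHb.
      * destruct Hb.
  - exists (map Var (seq 0 N) ++ map Dia (descriptions F)). split.
    + intros a. rewrite in_app_iff, !in_map_iff. intros [[i [<- Hi]] | [c [<- Hc]]].
      * apply in_seq in Hi. cbn; lia.
      * now apply (bounded_descriptions N k F).
    + assert (Hdia : forall a x y, bounded N k a ->
        agree M (fun a => In a (map Var (seq 0 N) ++ map Dia (descriptions F))) x y ->
        sat M x (Dia a) -> sat M y (Dia a)).
      { intros a x y Ha H [x' [Hx' Hs]].
        (* [Dia c], with [c] describing the witness [x'], is in the new basis and so passes to [y];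
           its witness there agrees with [x'] up to depth [k]. *)
        destruct (descriptions_spec M F x') as [c [Hc Hspec]].
        assert (Hy : sat M y (Dia c)).
        { apply H; [apply in_app_iff; right; now apply in_map|].
          exists x'. split; auto. apply Hspec. intros b _. reflexivity. }
        destruct Hy as [y' [Hy' Hyc]]. exists y'. split; auto.
        apply Hspec in Hyc. apply (HA _ _ Hyc a Ha), Hs. }
      intros x y H a; induction a as [|i|a IH|a IHa b IHb|a IH]; cbn [bounded]; intros Hb.
      * reflexivity.
      * apply H. apply in_app_iff. left. apply in_map, in_seq. lia.
      * cbn [sat]. now rewrite IH.
      * cbn [sat]. now rewrite IHa, IHb.
      * split; apply Hdia; auto. intros b' Hb'. symmetry. now apply H.
Qed.

Lemma characteristic_formula (M : model) (N k : nat) (x : world M) :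
  exists c, bounded N k c /\ forall y, sat M y c <-> agree M (bounded N k) x y.
Proof.
  destruct (finite_basis M N k) as [F [HF HA]].
  destruct (descriptions_spec M F x) as [c [Hc Hspec]].
  exists c. split; [now apply (bounded_descriptions N k F)|].
  intros y. rewrite Hspec. split; [apply HA|].
  intros H a Ha. apply H. auto.
Qed.

(** Each formula of [F] splits [P] in two. [P] is general so that the induction applies to both
    halves. *)
Lemma finite_representatives (M : model) (F : list formula) (P : world M -> Prop) :
  exists l, forall x, P x -> exists y, In y l /\ P y /\ agree M (fun a => In a F) x y.
Proof.
  revert P; induction F as [|a F IH]; intros P.
  - destruct (classic (exists x, P x)) as [[x Hx] | Hn].
    + exists [x]. intros y Hy. exists x. split; [now left|].
      split; auto. intros b [].
    + exists []. intros x Hx. destruct Hn. eauto.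
  - destruct (IH (fun x => P x /\ sat M x a)) as [l1 H1].
    destruct (IH (fun x => P x /\ ~ sat M x a)) as [l2 H2].
    exists (l1 ++ l2). intros x Hx. destruct (classic (sat M x a)) as [Ha | Ha].
    + destruct (H1 x (conj Hx Ha)) as [y [Hy [[HP Hs] HF]]]. exists y.
      split; [apply in_app_iff; now left|]. split; auto.
      intros b [<- | Hb]; [tauto | now apply HF].
    + destruct (H2 x (conj Hx Ha)) as [y [Hy [[HP Hs] HF]]]. exists y.
      split; [apply in_app_iff; now right|]. split; auto.
      intros b [<- | Hb]; [tauto | now apply HF].
Qed.

(** One [option] layer per entry gives an index type for the list; repeated entries get distinct
    indices. *)
Lemma list_as_finite_type {T : Type} (l : list T) :
  exists (A : Type) (f : A -> T), Finite A /\ forall x, In x l <-> exists a, f a = x.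
Proof.
  induction l as [|t l [A [f [[e He] Hf]]]].
  - exists Empty_set, (fun a : Empty_set => match a with end). split; [exists []; intros []|].
    intros x. split; [intros [] | intros [[] _]].
  - exists (option A), (fun o => match o with Some a => f a | None => t end). split.
    + exists (None :: map Some e). intros [a |]; [right | now left]. apply in_map, He.
    + intros x. cbn [In]. rewrite Hf. split.
      * intros [<- | [a <-]]; [now exists None | now exists (Some a)].
      * intros [[a |] <-]; eauto.
Qed.

(** * The layered finite model *)

Section Layered.

Variables (M : model) (N d : nat) (A : Type) (level : A -> nat) (point : A -> world M).

Hypothesis cover : forall k x, k <= d ->
  exists a, level a = k /\ agree M (bounded N k) x (point a).
Hypothesis level_le : forall a, level a <= d.

(** From level [S k], the body of a diamond of admissible depth has depth at most [k], so a target
    of any level from [k] up still evaluates it faithfully. *)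
Definition layered_acc (a b : A) : Prop :=
  level a <= S (level b) /\
  forall k, level a = S k ->
    exists y, acc M (point a) y /\ agree M (bounded N k) (point b) y.

Definition layered_model : model := {|
  world := A;
  acc := layered_acc;
  val := fun i a => val M i (point a)
|}.

Lemma layered_acc_descend (a : A) (k : nat) (y : world M) :
  level a = S k -> acc M (point a) y ->
  exists b, layered_acc a b /\ level b = k /\ agree M (bounded N k) y (point b).
Proof.
  intros Ha Hy. destruct (cover k y) as [b [Hb Heq]].
  { specialize (level_le a). lia. }
  exists b. split; [split; [lia|] | now split].
  intros k' Hk'. exists y. split; auto.
  replace k' with k by lia. intros c Hc. symmetry. now apply Heq.
Qed.

Lemma sat_layered (c : formula) (a : A) :
  bounded N (level a) c -> (sat layered_model a c <-> sat M (point a) c).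
Proof.
  revert a; induction c as [|i|c IH|c IHc e IHe|c IH]; intros a; cbn [bounded]; intros Hc.
  - reflexivity.
  - reflexivity.
  - cbn [sat]. now rewrite IH.
  - cbn [sat]. now rewrite IHc, IHe.
  - destruct (level a) as [|k] eqn:Ha; [easy|]. split.
    + intros [b [[Hle Hb] Hs]]. apply IH in Hs.
      2:{ apply (bounded_mono N _ k); auto; lia. }
      destruct (Hb k Ha) as [y [Hy Heq]]. exists y. split; auto. now apply Heq.
    + intros [y [Hy Hs]].
      destruct (layered_acc_descend a k y Ha Hy) as [b [Hab [Hb Heq]]].
      exists b. split; auto. apply IH; [congruence|]. now apply Heq.
Qed.

Lemma path_layered_sat (j : nat) (a b : A) :
  path layered_acc j a b -> j <= level a ->
  level a <= level b + j /\
  forall c, bounded N (level a - j) c -> sat M (point b) c -> sat M (point a) (DiaN j c).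
Proof.
  revert a; induction j as [|j IH]; intros a.
  - cbn. intros -> _. split; auto; lia.
  - intros [z [[Hle Hz] Hp]] Hj. destruct (level a) as [|k] eqn:Ha; [lia|].
    destruct (IH z Hp ltac:(lia)) as [Hl Hc]. split; [lia|].
    intros c Hb Hs. destruct (Hz k eq_refl) as [y [Hy Heq]].
    exists y. split; auto. apply Heq.
    + replace k with (j + (S k - S j)) by lia. now apply bounded_DiaN.
    + apply Hc; auto. apply (bounded_mono N _ (S k - S j)); auto; lia.
Qed.

(** Each diamond witness is replaced by a world covering it exactly one level lower. Knowing the
    final level exactly allows a chosen last edge to be checked later. *)
Lemma path_layered_descend (j : nat) (a : A) (c : formula) :
  j <= level a -> bounded N (level a - j) c -> sat M (point a) (DiaN j c) ->
  exists b, path layered_acc j a b /\ level b = level a - j /\ sat M (point b) c.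
Proof.
  revert a; induction j as [|j IH]; intros a Hj Hc Hs.
  - exists a. cbn. repeat split; auto; lia.
  - destruct (level a) as [|k] eqn:Ha; [lia|]. destruct Hs as [y [Hy Hs]].
    destruct (layered_acc_descend a k y Ha Hy) as [z [Haz [Hz Heq]]].
    change (S k - S j) with (k - j) in Hc.
    destruct (IH z) as [b [Hp [Hb Hsb]]]; rewrite ?Hz; auto; [lia| |].
    + apply Heq; auto. change (bounded N k (DiaN j c)).
      replace k with (j + (k - j)) by lia. now apply bounded_DiaN.
    + exists b. split; [now exists z|]. split; auto. lia.
Qed.

(** At level 0 the path loops at [a] and spends its last step on [b]; hence the length is a
    successor. *)
Lemma path_from_level_0 (n : nat) (a b : A) :
  level a = 0 -> path layered_acc (S n) a b.
Proof.
  intros Ha. assert (H : forall b, layered_acc a b) by (split; [lia | intros; lia]).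
  induction n as [|n IH].
  - exists b. cbn. auto.
  - exists a. auto.
Qed.

(** The hypothesis on [Top] ensures that the descent from [a] reaches level 0 without getting stuck,
    with at least one step left. *)
Lemma path_below_level (n : nat) (a b : A) :
  level a < n -> sat M (point a) (DiaN (level a) Top) -> path layered_acc n a b.
Proof.
  intros Hn Hs.
  destruct (path_layered_descend (level a) a Top) as [z [Hp [Hz _]]]; auto; [exact I|].
  replace n with (level a + S (n - level a - 1)) by lia. apply path_app.
  exists z. split; auto. apply path_from_level_0. lia.
Qed.

Lemma path_layered_lengthen (m n : nat) (a b : A) :
  m < n ->
  (forall c x, sat M x (DiaN m c) -> sat M x (DiaN n c)) ->
  path layered_acc m a b -> path layered_acc n a b.
Proof.
  intros Hmn HM Hp. destruct (le_lt_dec (level a) m) as [Hm | Hm].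
  (* The first [level a] steps of the given path witness the required diamonds. *)
  - apply path_below_level; [lia|].
    replace m with (level a + (m - level a)) in Hp by lia.
    apply path_app in Hp as [z [Hp _]].
    destruct (path_layered_sat _ _ _ Hp) as [_ H]; auto. apply H; cbn; tauto.
  - destruct (path_layered_sat _ _ _ Hp) as [Hl H]; [lia|].
    destruct (le_lt_dec n (level a)) as [Hn | Hn].
    + destruct n as [|n]; [lia|].
      destruct (characteristic_formula M N (level a - S n) (point b)) as [c [Hc Hspec]].
      (* Here [n] is one less than the target length. Only [n] diamonds are followed down, so that
         the last edge can be aimed at [b] itself. *)
      assert (Hs : sat M (point a) (DiaN n (Dia c))).
      { rewrite <- DiaN_succ_r. apply HM, H.
        - apply (bounded_mono N _ (level a - S n)); auto; lia.
        - apply Hspec. intros e _. reflexivity. }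
      destruct (path_layered_descend n a (Dia c)) as [z [Hz [Hlz [y [Hy Hyc]]]]]; auto.
      * lia.
      * replace (level a - n) with (S (level a - S n)) by lia. exact Hc.
      * replace (S n) with (n + 1) by lia. apply path_app. exists z. split; auto.
        (* The level condition holds because [a] is at most [m] levels above [b] and the descent to
           [z] lost [n] levels, with [n] at least [m]. *)
        exists b. split; [|reflexivity]. split; [lia|].
        intros k Hk. exists y. split; auto.
        replace k with (level a - S n) by lia. now apply Hspec.
    + apply path_below_level; auto.
      (* The axiom gives a path of length [n] in [M]; its first [level a] steps suffice for the
         descent to level 0. *)
      assert (Hs : sat M (point a) (DiaN n Top)) by (apply HM, H; cbn; tauto).
      apply sat_DiaN in Hs as [y [Hy _]].
      replace n with (level a + (n - level a)) in Hy by lia.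
      apply path_app in Hy as [z [Hz _]].
      apply sat_DiaN. exists z. split; auto. cbn; tauto.
Qed.

End Layered.

(** * Assembling the finite countermodel *)

Theorem mainTheorem1 (Phi : formula -> Prop)
  (hPhi : forall a, Phi a ->
     exists p m n : nat, 1 < m /\ m < n /\
       a = Imp (DiaN m (Var p)) (DiaN n (Var p))) :
  finite_model_property (K_plus Phi).
Proof.
  intros a Ha.
  pose proof (normal_logic_K_plus Phi) as HL.
  set (M := canonical_model (K_plus Phi)).
  destruct (canonical_refutes _ HL a Ha) as [r Hr]. fold M in r, Hr.
  destruct (bounded_exists a) as [N [d Hd]].
  destruct (finite_basis M N d) as [F [_ HF]].
  (* Representatives for the top depth [d] serve every level, since agreement up to depth [d]
     implies agreement up to any smaller depth. *)
  destruct (finite_representatives M F (fun _ => True)) as [reps Hreps].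
  destruct (list_as_finite_type (list_prod (seq 0 (S d)) reps)) as [A [f [HA Hf]]].
  set (level := fun a => fst (f a)). set (point := fun a => snd (f a)).
  assert (Hin : forall k x, k <= d -> exists b,
             level b = k /\ agree M (bounded N k) x (point b)).
  { intros k x Hk. destruct (Hreps x I) as [y [Hy [_ Hxy]]]. apply HF in Hxy.
    destruct (proj1 (Hf (k, y))) as [b Hb].
    - apply in_prod; auto. apply in_seq. lia.
    - exists b. unfold level, point. rewrite Hb. split; auto.
      intros c Hc. apply Hxy. now apply (bounded_mono N _ k). }
  assert (Hle : forall b, level b <= d).
  { intros b. assert (Hb : In (f b) (list_prod (seq 0 (S d)) reps)) by (apply Hf; eauto).
    unfold level. destruct (f b) as [k y]. apply in_prod_iff in Hb as [Hb _].
    apply in_seq in Hb. cbn. lia. }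
  exists (layered_model M N A level point). split; [exact HA|]. split.
  (* [K_plus Phi] is contained in every normal logic that includes [Phi], in particular in the logic
     of the layered frame. *)
  - intros b Hb w. apply (Hb (frame_valid A (layered_acc M N A level point))).
    + apply normal_logic_frame_valid.
    + intros c Hc. destruct (hPhi c Hc) as [p [m [n [_ [Hmn ->]]]]].
      apply frame_valid_DiaN. intros x y.
      apply (path_layered_lengthen M N d A level point); auto.
      intros c z. rewrite <- sat_imp. apply canonical_validates; auto.
      (* Substituting an arbitrary [c] for the variable makes the axiom available in [M] for every
         formula, characteristic ones included. *)
      apply K_plus_axiom, (nl_subst _ HL (fun _ => c)) in Hc.
      unfold Imp in Hc |- *. cbn [subst] in Hc. now rewrite !subst_DiaN in Hc.
  (* The refuting world is placed at the top level [d], where formulas of the full depth of [a] keep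
     their truth value. *)
  - destruct (Hin d r (le_n d)) as [b [Hb Heq]]. exists b.
    rewrite (sat_layered M N d A level point); auto; [|congruence].
    intros Hs. apply Hr. now apply Heq.
Qed.
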